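(* There exist transcendental entire functions $f$ and $g$ and a domain in $\mathbb{C}$ which lies in a periodic component of $F(f)$ and in a wandering component of $F(g)$, and lies in a periodic component of $F(g\circ f)$ and in a periodic component of $F(f\circ g)$.
   Context: A domain is a nonempty open connected subset of $\mathbb{C}$. For a transcendental entire function $h$, $h^n$ denotes its $n$-th iterate, and the Fatou set is $F(h)=\{z\in\mathbb{C}: \{h^n\}_{n\in\mathbb{N}} \text{ is normal in some neighborhood of } z\}$. A component of $F(h)$ means a connected component. For a component $U$ of $F(h)$ and $k\ge 0$, let $U_k$ denote the component of $F(h)$ containing $h^k(U)$ (so $U_0=U$). The component $U$ is called wandering if $U_k\cap U_l=\emptyset$ for all $k\neq l$; otherwise it is called preperiodic. It is called periodic if $U_k=U$ for some $k\ge 1$. A domain lies in a wandering (resp. periodic, preperiodic) component of $h$ if it is contained in some wandering (resp. periodic, preperiodic) component of $F(h)$. If $f,g$ are transcendental entire, so are $f\circ g$ and $g\circ f$, and these notions apply to them. *)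

(* Defs.v *)
From HB Require Import structures.
From mathcomp Require Import all_boot all_order all_algebra.
From mathcomp Require Import all_classical all_reals all_analysis.
From mathcomp Require Import complex.

Set Implicit Arguments.
Unset Strict Implicit.
Unset Printing Implicit Defensive.

Import Order.TTheory GRing.Theory Num.Theory numFieldNormedType.Exports.

Local Open Scope classical_set_scope.
Local Open Scope ring_scope.

(* The bare type R[i] carries no topology; typed as a numClosedFieldType it
   inherits the normed-module topology of the modulus. *)
Definition Cplx (R : realType) : numClosedFieldType := R[i]%C.

Section ComplexDynamics.
Context {R : realType}.
Local Notation C := (Cplx R).
Implicit Types (h : C -> C) (U D : set C).

Definition is_domain D := [/\ D !=set0, open D & connected D].

(* [derivable h z 1] is complex differentiability: the scalars are C. *)
Definition entire h := forall z : C, derivable h z 1.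

Definition transcendental_entire h :=
  entire h /\ ~ exists p : {poly C}, forall z, h z = p.[z].

(* Uniform convergence on compact subsets of U to a finite limit, or to
   infinity.  The threshold M is real because the order of C is partial. *)
Definition compact_cvg U (u : nat -> C -> C) (g : C -> C) :=
  forall K : set C, compact K -> K `<=` U -> {uniform K, u @ \oo --> g}.

Definition compact_cvg_infty U (u : nat -> C -> C) :=
  forall K : set C, compact K -> K `<=` U ->
    forall M : R, \forall n \near \oo, forall z, K z -> M%:C%C < `|u n z|.

(* Normality in the sense of Montel for families of entire functions. *)
Definition normal_on U (Fam : set (C -> C)) :=
  forall u : nat -> C -> C, (forall n, Fam (u n)) ->
    exists s : nat -> nat, increasing_seq s /\
      ((exists g : C -> C, compact_cvg U (u \o s) g) \/
       compact_cvg_infty U (u \o s)).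

Definition fatou h : set C :=
  [set z | exists U, [/\ open U, U z &
                         normal_on U [set iter n h | n in [set: nat]]]].

Definition fatou_component h U :=
  exists2 z, fatou h z & U = connected_component (fatou h) z.

(* U_k, the component of the Fatou set containing h^k(U).  For h nonconstant
   entire and U a component, there is exactly one such component: h^k(U) is
   nonempty, connected, and contained in the Fatou set. *)
Definition component_image h U (k : nat) : set C :=
  get [set V | fatou_component h V /\ iter k h @` U `<=` V].

Definition wandering h U :=
  fatou_component h U /\
  forall k l : nat, k <> l ->
    component_image h U k `&` component_image h U l = set0.

Definition periodic h U :=
  fatou_component h U /\ exists2 k : nat, (0 < k)%N & component_image h U k = U.

Definition lies_in_wandering h D := exists2 U, wandering h U & D `<=` U.

Definition lies_in_periodic h D := exists2 U, periodic h U & D `<=` U.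

End ComplexDynamics.

(* Main.v *)
Require Import Defs.
From mathcomp Require Import all_boot all_order all_algebra.
From mathcomp Require Import all_classical all_reals all_analysis.
From mathcomp Require Import complex ring lra zify.

Set Implicit Arguments.
Unset Strict Implicit.
Unset Printing Implicit Defensive.

Import Order.TTheory GRing.Theory Num.Theory numFieldNormedType.Exports.

Local Open Scope classical_set_scope.
Local Open Scope ring_scope.

(** The map g, called [drift] below, is

      g z = z + 1/2 + 3 pi i e^z - e^(2z)/2 - pi i e^(3z),

    and the map f is [small_exp eps], f z = eps (e^z - 1) with a tiny
    eps > 0; the domain is a small disc D around 0.

    Why g wanders.  It commutes with the translation by 2 pi i, g 0 = 2 pi i
    and g' 0 = 0, so g^n maps D into shrinking discs around 2 pi i n; hence D
    lies in the Fatou set and its points escape to infinity.  Escaping is a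
    local property on the Fatou set: where the iterates form a normal family,
    they cannot tend to infinity at one point and stay bounded along a
    subsequence at another ([escapes_normal]).  So the whole component of a
    point 2 pi i n escapes.  But g preserves each horizontal line
    Im z = pi/2 + 2 pi k, where exp z is purely imaginary, and acts on it by
    a real map x |-> x + 1/2 - 3 pi e^x + e^(2x)/2 - pi e^(3x), none of whose
    orbits escapes ([line_map_recurrent]): far to the left it moves points
    slowly to the right, far to the right it throws them to the left.  The
    components of the points 2 pi i n therefore avoid these lines and sit in
    different strips between them.

    Why the three other maps are periodic on D.  The map f has period 2 pi i,
    vanishes at 0 and at 2 pi i, and is as small as desired on a given disc.
    So 0 is an attracting fixed point of f and of f o g, and its basin
    contains D, while 2 pi i is an attracting fixed point of g o f whose basin
    contains the disc of radius 10 around it, hence both D and the fixed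
    point.  An attracting fixed point has a Fatou component that coincides
    with a component of its basin and is mapped into itself
    ([attracting_periodic]). *)

(** * The modulus as a real number *)

Lemma derive_bound (K : numFieldType) (h : K -> K) (z l : K) :
  is_derive z 1 h l -> forall e : K, 0 < e ->
  \forall w \near (0 : K), `|h (w + z) - h z - l * w| <= e * `|w|.
Proof.
case=> [+ lh] e e0; rewrite /derivable => /cvg_ex[l' hl'].
have ll' : l = l'.
  by rewrite -lh /derive; apply: cvg_lim hl'; exact: norm_hausdorff.
move: hl' => /cvgrPdist_le/(_ _ e0)[d /= d0]; rewrite -ll' => hd.
apply/nbhs_ballP; exists d => // w wd.
have [->|w0] := eqVneq w 0.
  by rewrite add0r subrr mulr0 subr0 normr0 mulr0.
have -> : h (w + z) - h z - l * w = (w^-1 *: (h (w *: 1 + z) - h z) - l) * w.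
  by rewrite mulrBl /GRing.scale /= mulr1 [w^-1 * _]mulrC -mulrA mulVf // mulr1.
by rewrite normrM ler_wpM2r // distrC; exact: hd.
Qed.

Section Modulus.
Context {R : realType}.
Local Notation C := (Cplx R).
Implicit Types (z w : C) (x : R).

(** The norm of the normed module takes complex values, and the order on complex
    numbers is partial.  A real modulus lets neighbourhoods, limits and
    derivatives be stated with real radii, and inequalities between them be
    settled by linear arithmetic. *)
Definition modulus z : R := ComplexField.Normc.normc z.

Lemma normE z : `|z| = (modulus z)%:C%C.
Proof. by []. Qed.

Lemma modulus_ge0 z : 0 <= modulus z.
Proof. by rewrite -lecR -normE normr_ge0. Qed.

Lemma modulusD z w : modulus (z + w) <= modulus z + modulus w.
Proof. exact: le_normcD. Qed.

Lemma modulusN z : modulus (- z) = modulus z.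
Proof. exact: normcN. Qed.

Lemma modulusB z w : modulus (z - w) = modulus (w - z).
Proof. by rewrite -modulusN opprB. Qed.

Lemma modulusM z w : modulus (z * w) = modulus z * modulus w.
Proof. exact: ComplexField.Normc.normcM. Qed.

Lemma modulus0 : modulus 0 = 0.
Proof. exact: ComplexField.Normc.normc0. Qed.

Lemma modulus_real x : modulus (x%:C)%C = `|x|.
Proof. by rewrite /modulus /= expr0n addr0 sqrtr_sqr. Qed.

Lemma modulus_im x : modulus (x *i)%C = `|x|.
Proof. by rewrite /modulus /= expr0n add0r sqrtr_sqr. Qed.

Lemma Re_le_modulus z : `|complex.Re z| <= modulus z.
Proof.
case: z => a b; rewrite /modulus /= -sqrtr_sqr ler_sqrt ?lerDl ?sqr_ge0 //.
by rewrite addr_ge0 ?sqr_ge0.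
Qed.

Lemma Im_le_modulus z : `|complex.Im z| <= modulus z.
Proof.
case: z => a b; rewrite /modulus /= -sqrtr_sqr ler_sqrt ?lerDr ?sqr_ge0 //.
by rewrite addr_ge0 ?sqr_ge0.
Qed.

Lemma nbhs_modulus z (A : set C) :
  nbhs z A <-> exists2 r : R, 0 < r & forall w, modulus (w - z) < r -> A w.
Proof.
split=> [/nbhs_ballP[e /= e0 sA]|[r r0 sA]]; last apply/nbhs_ballP.
  move: e e0 sA => [e i]; rewrite ltcE /= => /andP[/eqP -> e0] sA.
  exists e => // w wz; apply: sA; rewrite /ball/= normE.
  by rewrite modulusB ltcR.
exists (r%:C)%C => [/=|w]; first by rewrite ltcR.
by rewrite /ball/= normE ltcR => zw; apply: sA; rewrite modulusB.
Qed.

Definition modulus_ball z (r : R) : set C := [set w | modulus (w - z) < r].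

Lemma open_modulus_ball z (r : R) : open (modulus_ball z r).
Proof.
rewrite openE => w /= wz; apply/nbhs_modulus.
exists (r - modulus (w - z)); first by rewrite subr_gt0.
move=> v vw; rewrite /modulus_ball /mkset -(subrK w v) -addrA.
by apply: le_lt_trans (modulusD _ _) _; rewrite -ltrBrDr.
Qed.

Lemma continuous_modulusP (h : C -> C) z : {for z, continuous h} <->
  forall e : R, 0 < e -> exists2 d : R, 0 < d &
    forall w, modulus (w - z) < d -> modulus (h w - h z) < e.
Proof.
split=> [hz e e0|hz A].
  have /hz : nbhs (h z) [set w | modulus (w - h z) < e].
    by apply/nbhs_modulus; exists e.
  by move/nbhs_modulus.
move=> /nbhs_modulus[e e0 sA]; apply/nbhs_modulus.
by have [d d0 hd] := hz e e0; exists d => // w /hd /sA.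
Qed.

Lemma derive_modulus (h : C -> C) z (l : C) : is_derive z 1 h l ->
  forall e : R, 0 < e -> exists2 d : R, 0 < d & forall w, modulus w < d ->
    modulus (h (w + z) - h z - l * w) <= e * modulus w.
Proof.
move=> hl e e0; have eC : 0 < (e%:C)%C :> C by rewrite ltcR.
have /nbhs_modulus[d d0 hd] := derive_bound hl eC.
exists d => // w wd; have := hd w.
by rewrite subr0 !normE -rmorphM lecR; apply.
Qed.

Lemma is_derive_modulus (h : C -> C) z (l : C) :
  (forall e : R, 0 < e -> exists2 d : R, 0 < d &
    forall w, modulus w < d ->
      modulus (h (w + z) - h z - l * w) <= e * modulus w) ->
  is_derive z 1 h l.
Proof.
move=> hl.
have hc : (fun w : C => w^-1 *: (h (w *: 1 + z) - h z)) @ 0^' --> l.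
  move=> A /nbhs_modulus[e e0 sA].
  have [|d d0 hd] := hl (e / 2); first by rewrite divr_gt0.
  exists (d%:C)%C => [/=|w]; first by rewrite ltcR.
  rewrite /= sub0r normrN normE ltcR => wd w0; apply: sA.
  have mw : 0 < modulus w by rewrite -ltcR -normE normr_gt0.
  have -> : w^-1 *: (h (w *: 1 + z) - h z) - l =
      (h (w + z) - h z - l * w) * w^-1.
    rewrite mulrBl -mulrA divff // mulr1 /GRing.scale /= mulr1.
    by rewrite mulrC.
  rewrite modulusM {2}/modulus ComplexField.Normc.normcV ltr_pdivrMr //.
  apply: le_lt_trans (hd _ wd) _.
  by rewrite ltr_pM2r // ltr_pdivrMr // ltr_pMr // ltr1n.
apply: DeriveDef; first by apply/cvg_ex; exists l.
by rewrite /derive; apply: cvg_lim hc; exact: norm_hausdorff.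
Qed.
End Modulus.

(** * The complex exponential *)

Section ComplexExponential.
Context {R : realType}.
Local Notation C := (Cplx R).
Implicit Types (z w : C) (x : R).

Definition cexp z : C :=
  (expR (complex.Re z) * cos (complex.Im z)
     +i* (expR (complex.Re z) * sin (complex.Im z)))%C.

Lemma cexpD z w : cexp (z + w) = cexp z * cexp w.
Proof.
case: z w => [a b] [c d]; rewrite /cexp /= expRD cosD sinD.
by apply/eqP; rewrite eq_complex /=; apply/andP; split; apply/eqP; ring.
Qed.

Lemma cexp0 : cexp 0 = 1.
Proof. by rewrite /cexp /= expR0 cos0 sin0 mulr1 mulr0. Qed.

Lemma modulus_cexp z : modulus (cexp z) = expR (complex.Re z).
Proof.
rewrite /modulus /= !exprMn -mulrDr cos2Dsin2 mulr1 sqrtr_sqr.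
by rewrite ger0_norm ?expR_ge0.
Qed.

Lemma real_derive_bound (h : R -> R) x (l : R) : is_derive x 1 h l ->
  forall e : R, 0 < e -> exists2 d : R, 0 < d &
    forall y, `|y| < d -> `|h (y + x) - h x - l * y| <= e * `|y|.
Proof.
move=> hl e e0; have /nbhs_ballP[d /= d0 hd] := derive_bound hl e0.
by exists d => // y yd; apply: hd; rewrite /ball /= sub0r normrN.
Qed.

(** With w = a + i b,
      exp w - 1 - w = e^a (cos b - 1) + (e^a - 1 - a)
                      + i (e^a (sin b - b) + (e^a - 1) b),
    so differentiability at 0 reduces to that of the real exponential, sine
    and cosine. *)
Lemma cexp_derive0 (e : R) : 0 < e -> exists2 d : R, 0 < d &
  forall w, modulus w < d -> modulus (cexp w - 1 - w) <= e * modulus w.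
Proof.
move=> e0.
(* Six terms of size e' |w| appear in the final estimate. *)
pose e' := Num.min 1 (e / 6).
have e'0 : 0 < e' by rewrite lt_min ltr01 divr_gt0.
have e'1 : e' <= 1 by rewrite ge_min lexx.
have e'e : 6 * e' <= e by rewrite mulrC -ler_pdivlMr // ge_min lexx orbT.
have [d1 d10 h1] := real_derive_bound (is_derive_expR 0) e'0.
have [d2 d20 h2] := real_derive_bound (is_derive_sin 0) e'0.
have [d3 d30 h3] := real_derive_bound (is_derive_cos 0) e'0.
exists (Num.min (e' / 2) (Num.min d1 (Num.min d2 d3))).
  by rewrite !lt_min d10 d20 d30 divr_gt0.
move=> w; rewrite !lt_min => /and4P[we w1 w2 w3].
have := Re_le_modulus w; have := Im_le_modulus w; have := modulus_ge0 w.
move: (modulus w) we w1 w2 w3 => m we w1 w2 w3 m0.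
case: w => a b; rewrite [complex.Re _]/= [complex.Im _]/= => bm am.
have := h1 a (le_lt_trans am w1); have := h2 b (le_lt_trans bm w2).
have := h3 b (le_lt_trans bm w3).
rewrite !addr0 expR0 sin0 cos0 oppr0 !mul1r mul0r !subr0 addr0.
move=> hc hs he.
rewrite [X in modulus X](_ : _ =
  (((expR a * (cos b - 1) + (expR a - 1 - a))%:C)%C : C) +
   ((expR a * (sin b - b) + (expR a - 1) * b) *i)%C); last first.
  rewrite /cexp /=; apply/eqP; rewrite eq_complex /=; apply/andP.
  by split; apply/eqP; ring.
apply: le_trans (modulusD _ _) _; rewrite modulus_real modulus_im.
have eem : `|expR a - 1| <= e'.
  have -> : expR a - 1 = (expR a - 1 - a) + a by ring.
  apply: le_trans (ler_normD _ _) _.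
  nra.
have ea2 : `|expR a| <= 2.
  have -> : expR a = (expR a - 1) + 1 by ring.
  by apply: le_trans (ler_normD _ _) _; rewrite normr1; lra.
have n1 := ler_normD (expR a * (cos b - 1)) (expR a - 1 - a).
have n2 := ler_normD (expR a * (sin b - b)) ((expR a - 1) * b).
rewrite !normrM in n1 n2.
have c1 : `|expR a| * `|cos b - 1| <= 2 * (e' * m).
  by apply: ler_pM => //; apply: le_trans hc _; rewrite ler_pM2l.
have c2 : `|expR a| * `|sin b - b| <= 2 * (e' * m).
  by apply: ler_pM => //; apply: le_trans hs _; rewrite ler_pM2l.
have c3 : `|expR a - 1| * `|b| <= e' * m by apply: ler_pM.
have c4 : e' * `|a| <= e' * m by rewrite ler_pM2l.
have c5 : 6 * e' * m <= e * m by rewrite ler_wpM2r.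
lra.
Qed.

Lemma is_derive_cexp z : is_derive z 1 cexp (cexp z).
Proof.
apply: is_derive_modulus => e e0.
have ez : 0 < modulus (cexp z) by rewrite modulus_cexp expR_gt0.
have [|d d0 hd] := @cexp_derive0 (e / modulus (cexp z)); first exact: divr_gt0.
exists d => // w /hd hw.
have -> : cexp (w + z) - cexp z - cexp z * w = (cexp w - 1 - w) * cexp z.
  by rewrite cexpD; ring.
rewrite modulusM; apply: le_trans (ler_wpM2r (ltW ez) hw) _.
by rewrite mulrAC divfK ?lt0r_neq0.
Qed.

Definition two_pi_i : C := (0 +i* (pi *+ 2))%C.

Lemma cexp_period z : cexp (z + two_pi_i) = cexp z.
Proof.
case: z => a b; rewrite /cexp /two_pi_i /= addr0.
by rewrite -[b + _]/(b + (pi *+ 2)) cosD2pi sinD2pi.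
Qed.

Lemma cexp_period_nat z (n : nat) : cexp (z + n%:R * two_pi_i) = cexp z.
Proof.
elim: n => [|n ih]; first by rewrite mul0r addr0.
by rewrite -natr1 mulrDl mul1r addrA cexp_period.
Qed.

End ComplexExponential.

(** * Subsequences and connectedness *)

Section Subsequences.

Lemma subsequence_choice (P : nat -> nat -> Prop) :
  (forall j m, exists2 i, (m < i)%N & P j i) ->
  exists s : nat -> nat, increasing_seq s /\ forall j, P j (s j).
Proof.
move=> hP.
have [c hc] : exists c : nat -> nat -> nat,
    forall j m, (m < c j m)%N /\ P j (c j m).
  have : forall jm : nat * nat, exists i, (jm.2 < i)%N /\ P jm.1 i.
    by move=> [j m]; have [k] := hP j m; exists k.
  move=> /choice[c hc].
  by exists (fun j m => c (j, m)) => j m; exact: (hc (j, m)).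
pose s := fix s j := if j is j'.+1 then c j (s j') else c 0%N 0%N.
exists s; split; last by case=> [|j] /=; exact: (hc _ _).2.
by apply/increasing_seqP => j /=; exact: (hc _ _).1.
Qed.

Lemma increasing_seq_ge_id (s : nat -> nat) : increasing_seq s ->
  forall j, (j <= s j)%N.
Proof.
move=> /increasing_seqP hs; elim=> [//|j ih].
exact: leq_ltn_trans ih (hs j).
Qed.

Lemma infinite_value (n : nat -> nat) (N m0 : nat) :
  (forall i, (m0 < i)%N -> (n i < N)%N) ->
  exists k, forall m, exists2 i, (m < i)%N & n i = k.
Proof.
elim: N m0 => [|N ih] m0 hN; first by have := hN m0.+1 (leqnn _).
have [|] := pselect (forall m, exists2 i, (m < i)%N & n i = N).
  by exists N.
move=> /existsNP[m1 hm1]; apply: (ih (maxn m0 m1)) => i.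
rewrite gtn_max => /andP[/hN im0 im1].
move: im0; rewrite ltnS leq_eqVlt => /orP[/eqP iN|//].
by exfalso; apply: hm1; exists i.
Qed.

(** This makes normality of a family of iterates a statement about sequences
    of iterates whose orders tend to infinity: the other sequences have a
    constant subsequence. *)
Lemma constant_or_divergent_subsequence (n : nat -> nat) :
  exists s : nat -> nat, increasing_seq s /\
    ((exists k, forall j, n (s j) = k) \/ (forall j, (j <= n (s j))%N)).
Proof.
have [hN|] := pselect (forall N m, exists2 i, (m < i)%N & (N <= n i)%N).
  by have [s [sinc hs]] := subsequence_choice hN; exists s; split => //; right.
move=> /existsNP[N /existsNP[m hm]].
have [|k hk] := @infinite_value n N m.
  by move=> i im; rewrite ltnNge; apply/negP => Ni; apply: hm; exists i.
have [s [sinc hs]] := @subsequence_choice (fun _ i => n i = k) (fun _ => hk).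
by exists s; split => //; left; exists k.
Qed.

End Subsequences.

Section Topology.

Lemma connected_locally_constant (T : topologicalType) (V : set T)
    (P : T -> Prop) : connected V ->
  (forall z, V z -> exists W, [/\ open W, W z &
     forall w, W w -> V w -> (P w <-> P z)]) ->
  forall x y, V x -> V y -> P x -> P y.
Proof.
move=> cV hP x y Vx Vy Px.
pose O (Q : T -> Prop) := \bigcup_(W in [set W | open W /\
  forall w, W w -> V w -> Q w]) W.
have oO Q : open (O Q) by apply: bigcup_open => W [].
have OQ Q z : V z -> O Q z -> Q z by move=> Vz [W [_ hW] Wz]; exact: hW.
have OP z : V z -> P z -> O P z.
  move=> Vz Pz; have [W [oW Wz hW]] := hP z Vz.
  by exists W => //; split => // w Ww Vw; apply/(hW _ Ww Vw).
have ON z : V z -> ~ P z -> O (fun w => ~ P w) z.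
  move=> Vz Pz; have [W [oW Wz hW]] := hP z Vz.
  by exists W => //; split => // w Ww Vw /(hW _ Ww Vw).
suff E : V `&` P = V by have : (V `&` P) y; [rewrite E|case].
apply: cV.
- by exists x.
- exists (O P) => //; apply/seteqP; split => z [Vz]; last by move/(OQ _ _ Vz).
  by move/(OP _ Vz).
- exists (~` O (fun w => ~ P w)); first exact: open_closedC.
  apply/seteqP; split => z [Vz hz]; split => //.
    by move/(OQ _ _ Vz); apply.
  by apply: contrapT => /(ON _ Vz).
Qed.

(** Uniform convergence on such a set carries information about a limit
    function from the points of a sequence to their limit. *)
Lemma compact_range_limit (T : topologicalType) (z : T) (w : nat -> T) :
  (w @ \oo --> z) -> compact ([set z] `|` range w).
Proof.
move=> wz F PF FK.
have [hz|] := pselect (cluster F z); first by exists z; split => //; left.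
move=> /existsNP[S /existsNP[V /not_implyP[FS /not_implyP[zV SV]]]].
have [N _ hN] : \forall n \near \oo, V (w n) by exact: wz.
have fin : compact (w @` `I_N) by apply: finite_compact; exact: finite_image.
have [|x [[i _ <-] ci]] := fin F PF.
  apply: filterS (filterI FS FK) => x [Sx [xz|[i _ wi]]].
    exfalso; apply: SV; exists z; split; first by rewrite -xz.
    exact: nbhs_singleton.
  exists i => //; rewrite /= ltnNge; apply/negP => /hN Vi.
  by apply: SV; exists x; rewrite -wi in Sx *.
by exists (w i); split => //; right; exists i.
Qed.

End Topology.

(** * Escaping points and normality *)

Section Normality.
Context {R : realType}.
Local Notation C := (Cplx R).
Implicit Types (h : C -> C) (W V K : set C) (u : nat -> C -> C).

Lemma uniform_modulusP K u (g : C -> C) :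
  {uniform K, u @ \oo --> g} <-> forall e : R, 0 < e ->
    exists N, forall n, (N <= n)%N ->
      forall x, K x -> modulus (u n x - g x) < e.
Proof.
split=> [ug e e0|ug A].
  have : nbhs (g : {uniform` K -> C})
      [set v | forall x, K x -> modulus (v x - g x) < e].
    apply/uniform_nbhs; exists [set xy | ball xy.1 (e%:C)%C xy.2]; split.
      by rewrite -entourage_ballE; exists (e%:C)%C => //=; rewrite ltcR.
    move=> v /= hv x /hv; rewrite /ball /= normE ltcR.
    by rewrite modulusB.
  by move=> /ug[N _ hN]; exists N => n /hN.
move=> /uniform_nbhs[E [+ sA]]; rewrite -entourage_ballE => -[e /= e0 sE].
move: e e0 sE => [e i]; rewrite ltcE /= => /andP[/eqP -> e0] sE.
have [N hN] := ug e e0.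
exists N => // n /= Nn; apply: sA => x Kx; apply: sE.
by rewrite /ball /= normE ltcR modulusB; exact: hN.
Qed.

Definition escapes h z := forall M : R, exists N, forall n, (N <= n)%N ->
  M < modulus (iter n h z).

Lemma infty_modulus K u : (forall M : R, \forall n \near \oo,
    forall z, K z -> (M%:C)%C < `|u n z|) ->
  forall M : R, exists N, forall n, (N <= n)%N ->
    forall z, K z -> M < modulus (u n z).
Proof.
move=> hu M; have [N _ hN] := hu M; exists N => n /hN hn z /hn.
by rewrite normE ltcR.
Qed.

Lemma not_escapes_subsequence h z : ~ escapes h z ->
  exists M s, increasing_seq s /\ forall j, modulus (iter (s j) h z) <= M.
Proof.
move=> /existsNP[M hM]; exists M.
apply: (@subsequence_choice (fun _ n => modulus (iter n h z) <= M)) => _ m.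
apply: contrapT => hm; apply: hM; exists m.+1 => n mn.
by rewrite ltNge; apply/negP => nM; apply: hm; exists n.
Qed.

(** A subsequence of iterates that stays bounded at z has a subsequence that
    converges on W, to a finite limit because of z; this contradicts the
    escape of w. *)
Lemma escapes_normal h W z w :
  normal_on W [set iter n h | n in [set: nat]] ->
  W z -> W w -> escapes h w -> escapes h z.
Proof.
move=> nW Wz Ww ew; apply: contrapT.
move=> /not_escapes_subsequence[M [s [sinc hs]]].
have [|t [tinc [[g hg]|hinf]]] := nW (fun j => iter (s j) h).
- by move=> n; exists (s n).
- have /uniform_modulusP/(_ 1 ltr01)[N hN] : {uniform [set w],
      (fun j => iter (s j) h) \o t @ \oo --> g}.
    by apply: hg; [exact: compact_set1|move=> _ ->].
  have [N' hN'] := ew (modulus (g w) + 1).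
  pose n := maxn N N'.
  have : (N' <= s (t n))%N.
    apply: leq_trans (increasing_seq_ge_id sinc _).
    by apply: leq_trans (increasing_seq_ge_id tinc _); exact: leq_maxr.
  move=> /hN'; apply/negP; rewrite -leNgt.
  have := hN n (leq_maxl _ _) w erefl => /= /ltW hn.
  rewrite -[X in modulus X](subrK (g w)) addrC.
  by apply: le_trans (modulusD _ _) _; rewrite lerD2l.
- have [|N hN] := infty_modulus (hinf [set z] (@compact_set1 _ z) _) M.
    by move=> _ ->.
  have := hN N (leqnn N) z erefl => /=.
  by apply/negP; rewrite -leNgt.
Qed.

Lemma escapes_connected h V z w : connected V -> V `<=` Defs.fatou h ->
  V z -> V w -> escapes h w -> escapes h z.
Proof.
move=> cV VF Vz Vw; apply: (connected_locally_constant cV) Vw Vz => x /VF.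
move=> [W [oW Wx nW]]; exists W; split => // y Wy _.
by split; exact: (escapes_normal nW).
Qed.

Lemma normal_iterates h W :
  (forall n : nat -> nat, (forall j, (j <= n j)%N) ->
   (exists l, compact_cvg W (fun j => iter (n j) h) l) \/
   compact_cvg_infty W (fun j => iter (n j) h)) ->
  normal_on W [set iter n h | n in [set: nat]].
Proof.
move=> hW u hu.
have /choice[n hn] : forall j, exists n, iter n h = u j.
  by move=> j; have [n _] := hu j; exists n.
have [s [sinc [[k hk]|hs]]] := constant_or_divergent_subsequence n.
  exists s; split => //; left; exists (iter k h) => K _ _.
  apply/uniform_modulusP => e e0; exists 0%N => j _ x _ /=.
  by rewrite -hn hk subrr modulus0.
exists s; split => //.
have -> : u \o s = fun j => iter (n (s j)) h by apply/funext => j /=.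
exact: (hW _ hs).
Qed.

Lemma fatou_componentE h V x : fatou_component h V -> V x ->
  V = connected_component (Defs.fatou h) x.
Proof. by move=> [z Fz ->]; exact: same_connected_component. Qed.

(** The components containing the image of U under the k-th iterate number at
    most one, since such a component contains the k-th iterate of x.  When
    there is none, [get] returns the default set, which is empty. *)
Lemma component_imageP h U k x : U x ->
  component_image h U k = set0 \/
  (component_image h U k = connected_component (Defs.fatou h) (iter k h x) /\
   Defs.fatou h (iter k h x)).
Proof.
move=> Ux; rewrite /component_image.
case: xgetP => [V _ [cV hV]|_]; last by left.
have Vx : V (iter k h x) by apply: hV; exists x.
right; split; first exact: fatou_componentE cV Vx.
by case: cV Vx => z _ ->; exact: connected_component_sub.
Qed.

Lemma continuous_iter h n : continuous h -> continuous (iter n h).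
Proof.
move=> ch; elim: n => [|n ih] z; first exact: cvg_id.
by apply: continuous_comp; [exact: ih|exact: ch].
Qed.

End Normality.

(** * Basins of attracting fixed points *)

Section Basins.
Context {R : realType}.
Local Notation C := (Cplx R).
Implicit Types (h : C -> C) (p z w : C) (r : R).

(** A disc is the union of the segments from its center to its points. *)
Lemma connected_modulus_ball p r : connected (modulus_ball p r).
Proof.
pose seg z (t : R) : C := p + (t%:C)%C * (z - p).
have seg_modulus z (t s : R) :
    modulus (seg z t - seg z s) = `|t - s| * modulus (z - p).
  have -> : seg z t - seg z s = ((t - s)%:C)%C * (z - p).
    by rewrite rmorphB /seg; ring.
  by rewrite modulusM modulus_real.
have [r0|r0] := ltP 0 r; last first.
  rewrite (_ : modulus_ball p r = set0); first exact: connected0.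
  rewrite -subset0 => z; rewrite /modulus_ball /= => zr.
  have := le_lt_trans (modulus_ge0 (z - p)) (lt_le_trans zr r0).
  by rewrite ltxx.
have -> : modulus_ball p r =
    \bigcup_(z in modulus_ball p r) (seg z @` `[0, 1]).
  apply/seteqP; split => [z zr|w [z zr [t /= t01 <-]]].
    exists z => //; exists 1; rewrite /= ?in_itv /= ?ler01 ?lexx //.
    by rewrite /seg mul1r addrC subrK.
  have segp : p = seg z 0 by rewrite /seg mul0r addr0.
  rewrite /modulus_ball /= {1}segp seg_modulus subr0.
  move: t01; rewrite in_itv /= => /andP[t0 t1]; rewrite ger0_norm //.
  apply: le_lt_trans zr; rewrite -[leRHS]mul1r.
  by rewrite ler_wpM2r ?modulus_ge0.
apply: bigcup_connected.
  exists p => z zr; exists 0; rewrite /= ?in_itv /= ?ler01 ?lexx //.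
  by rewrite /seg mul0r addr0.
move=> z zr; apply: connected_continuous_connected.
  exact: segment_connected.
apply: continuous_subspaceT => t A /nbhs_modulus[e e0 sA].
apply/nbhs_ballP; exists (e / (modulus (z - p) + 1)) => /=.
  by rewrite divr_gt0 // ltr_wpDl ?modulus_ge0.
move=> s; rewrite /ball /= ltr_pdivlMr ?ltr_wpDl ?modulus_ge0 // => ts.
apply: sA; rewrite seg_modulus distrC; apply: le_lt_trans ts.
by rewrite ler_wpM2l // lerDl.
Qed.

Definition contracting_at h p r :=
  forall z, modulus (z - p) < r -> modulus (h z - p) <= modulus (z - p) / 2.

Lemma contracting_fixed h p r : 0 < r -> contracting_at h p r -> h p = p.
Proof.
move=> r0 /(_ p); rewrite subrr modulus0 mul0r => /(_ r0) hp.
apply/eqP; rewrite -subr_eq0; apply/eqP/ComplexField.Normc.eq0_normc.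
by apply/eqP; rewrite eq_le hp modulus_ge0.
Qed.

Lemma half_power_small (e : R) : 0 < e -> exists N, forall n, (N <= n)%N ->
  2^-1 ^+ n < e.
Proof.
move=> e0.
have [N _ hN] : \forall n \near \oo, 2^-1 ^+ n < e.
  have := @cvg_geometric R 1 2^-1; rewrite ger0_norm ?invr_ge0 //.
  rewrite invf_lt1 ?ltr1n // => /(_ isT) /cvgrPdist_lt/(_ _ e0).
  apply: filterS => n; rewrite sub0r normrN /geometric /= mul1r.
  by rewrite ger0_norm // exprn_ge0 // invr_ge0.
by exists N => n /hN.
Qed.

Lemma contracting_iter h p r n z : contracting_at h p r ->
  modulus (z - p) < r ->
  modulus (iter n h z - p) <= 2^-1 ^+ n * modulus (z - p).
Proof.
move=> hp zr; elim: n => [|n ih]; first by rewrite mul1r.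
have itr : modulus (iter n h z - p) < r.
  apply: le_lt_trans ih _; apply: le_lt_trans zr; rewrite -[leRHS]mul1r.
  by rewrite ler_wpM2r ?modulus_ge0 // exprn_ile1 ?invr_ge0 ?invf_le1 ?ler1n.
apply: le_trans (hp _ itr) _; rewrite exprS mulrC -mulrA ler_wpM2l //.
Qed.

(** For a map that contracts the disc of radius r around p, entering this disc
    once is equivalent to converging to p. *)
Definition basin h p r : set C :=
  [set z | exists n, modulus (iter n h z - p) < r].

Lemma ball_sub_basin h p r : modulus_ball p r `<=` basin h p r.
Proof. by move=> z zr; exists 0%N. Qed.

Lemma basin_uniform h p r m n w : contracting_at h p r ->
  modulus (iter m h w - p) < r ->
  modulus (iter (n + m) h w - p) <= 2^-1 ^+ n * r.
Proof.
move=> hp wr; rewrite iterD; apply: le_trans (contracting_iter _ hp wr) _.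
by rewrite ler_wpM2l ?(ltW wr) // exprn_ge0 // invr_ge0.
Qed.

Lemma open_entry h p r m : continuous h ->
  open [set w : C | modulus (iter m h w - p) < r].
Proof.
move=> ch.
have := @open_modulus_ball R p r.
by move/(open_comp (fun x _ => @continuous_iter R h m ch x)).
Qed.

Lemma entry_cvg h p r m (e : R) : 0 < r -> 0 < e -> contracting_at h p r ->
  exists N, forall n, (N <= n)%N -> forall w,
    modulus (iter m h w - p) < r -> modulus (iter n h w - p) < e.
Proof.
move=> r0 e0 hp.
have [|N hN] := @half_power_small (e / r); first exact: divr_gt0.
exists (N + m)%N => n Nn w /(basin_uniform (n - m) hp).
rewrite subnK; last by rewrite (leq_trans _ Nn) // leq_addl.
move=> /le_lt_trans; apply; rewrite -ltr_pdivlMr //; apply: hN; lia.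
Qed.

Lemma basin_sub_fatou h p r : continuous h -> 0 < r -> contracting_at h p r ->
  basin h p r `<=` Defs.fatou h.
Proof.
move=> ch r0 hp z [m zm].
exists [set w | modulus (iter m h w - p) < r]; split => //.
  exact: open_entry.
apply: normal_iterates => n hn; left; exists (fun=> p) => K _ KW.
apply/uniform_modulusP => e e0.
have [N hN] := entry_cvg m r0 e0 hp.
exists N => k Nk w /KW; apply: hN.
exact: leq_trans Nk (hn k).
Qed.

(** Take points w j of the basin tending to z.  A subsequence of the iterates
    converges uniformly on the compact set formed by z and the w j, to a limit
    equal to p at each w j.  Fix a late iterate in this subsequence: it maps
    every w j close to p, and by continuity it maps z close to the image of
    some w j, so z enters the disc. *)
Lemma basin_closed_in_fatou h p r z : continuous h -> 0 < r ->
  contracting_at h p r -> Defs.fatou h z -> closure (basin h p r) z ->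
  basin h p r z.
Proof.
move=> ch r0 hp [W [oW Wz nW]] clz.
(* Four errors of size r / 4 are added at the end. *)
have r4 : 0 < r / 4 by rewrite divr_gt0.
have /nbhs_modulus[d d0 dW] : nbhs z W by exact: open_nbhs_nbhs.
have /choice[w hw] : forall j : nat, exists w, [/\ basin h p r w,
    modulus (w - z) < d & modulus (w - z) < j.+1%:R^-1].
  move=> j; have [|w [bw /= [wd wj]]] := clz [set w | modulus (w - z) < d /\
      modulus (w - z) < j.+1%:R^-1].
    apply/nbhs_modulus; exists (Num.min d j.+1%:R^-1).
      by rewrite lt_min d0 invr_gt0 ltr0n.
    by move=> w; rewrite lt_min => /andP.
  by exists w.
have wz : w @ \oo --> z.
  move=> A /nbhs_modulus[e e0 sA].
  have [N _ hN] := near_infty_natSinv_lt (PosNum e0).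
  exists N => // n /hN /= en; apply: sA.
  by have [_ _ /lt_trans] := hw n; apply.
have KW : [set z] `|` range w `<=` W.
  by move=> x [->//|[j _ <-]]; apply: dW; have [] := hw j.
have cK := compact_range_limit wz.
have [|s [sinc [[g hg]|hinf]]] := nW (fun n => iter n h).
- by move=> n; exists n.
- have /uniform_modulusP/(_ _ r4)[N hN] := hg _ cK KW.
  have ciz := @continuous_iter _ h (s N) ch z.
  have /continuous_modulusP/(_ _ r4)[e e0 he] := ciz.
  have [N1 _ hN1] := near_infty_natSinv_lt (PosNum e0).
  pose v := w N1.
  have [[m vm] _ vz] := hw N1.
  have ve : modulus (v - z) < e.
    by apply: lt_trans vz _; exact: (hN1 N1 (leqnn N1)).
  have [N2 hN2] := entry_cvg m r0 r4 hp.
  pose n := maxn N N2.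
  have Kv : ([set z] `|` range w) v by right; exists N1.
  exists (s N).
  have a1 := he _ ve.
  have a2 := hN N (leqnn _) v Kv; rewrite /= in a2.
  have a3 := hN n (leq_maxl _ _) v Kv; rewrite /= in a3.
  have a4 : modulus (iter (s n) h v - p) < r / 4.
    apply: hN2 vm; apply: leq_trans (increasing_seq_ge_id sinc _).
    exact: leq_maxr.
  have -> : iter (s N) h z - p = (iter (s N) h z - iter (s N) h v) +
     ((iter (s N) h v - g v) + ((g v - iter (s n) h v) + (iter (s n) h v - p))).
    by ring.
  rewrite modulusB in a1; rewrite modulusB in a3.
  apply: le_lt_trans (modulusD _ _) _.
  have b1 := modulusD (iter (s N) h v - g v)
    ((g v - iter (s n) h v) + (iter (s n) h v - p)).
  have b2 := modulusD (g v - iter (s n) h v) (iter (s n) h v - p).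
  lra.
- have [[m vm] _ _] := hw 0%N.
  have [N hN] := infty_modulus (hinf _ cK KW) (modulus p + r).
  have [N2 hN2] := entry_cvg m r0 r0 hp.
  pose n := maxn N N2.
  have a1 := hN n (leq_maxl _ _) (w 0%N); rewrite /= in a1.
  have a2 : modulus (iter (s n) h (w 0%N) - p) < r.
    apply: hN2 vm; apply: leq_trans (increasing_seq_ge_id sinc _).
    exact: leq_maxr.
  have a3 := modulusD p (iter (s n) h (w 0%N) - p).
  rewrite addrC subrK in a3.
  have := a1 (or_intror (ex_intro2 _ _ 0%N I erefl)); lra.
Qed.

End Basins.

(** * Criteria for periodic and wandering components *)

Section PeriodicAndWandering.
Context {R : realType}.
Local Notation C := (Cplx R).
Implicit Types (h : C -> C) (p z w T : C) (r : R).

(** The basin is open, and closed in the Fatou set, so the component U of p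
    lies in the basin.  The basin is forward invariant and contained in the
    Fatou set, so h maps the connected set U into U. *)
Lemma attracting_periodic h p r (S D : set C) :
  continuous h -> 0 < r -> contracting_at h p r ->
  connected S -> S p -> S `<=` basin h p r -> D `<=` S -> lies_in_periodic h D.
Proof.
move=> ch r0 hp cS Sp SA DS.
have hpp := contracting_fixed r0 hp.
have AF := basin_sub_fatou ch r0 hp.
pose U := connected_component (Defs.fatou h) p.
have Fp : Defs.fatou h p by apply: AF; exact: SA.
have Up : U p by exact: connected_component_refl.
have cU : connected U by exact: component_connected.
have UF : U `<=` Defs.fatou h by exact: connected_component_sub.
have UA : U `<=` basin h p r.
  move=> z Uz; apply: (connected_locally_constant cU) Up Uz (SA _ Sp) => w Uw.
  have [bw|bw] := pselect (basin h p r w).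
    have [m wm] := bw.
    exists [set v | modulus (iter m h v - p) < r]; split => //.
      exact: open_entry.
    by move=> v vm _; split => // _; exists m.
  exists (~` closure (basin h p r)); split.
  - exact/closed_openC/closed_closure.
  - by move=> /(basin_closed_in_fatou ch r0 hp (UF _ Uw)).
  - by move=> v cv _; split => // bv; exfalso; apply: cv; exact: subset_closure.
exists U; last first.
  apply: (subset_trans DS); apply: connected_component_max => //.
  exact: subset_trans SA AF.
have FU : fatou_component h U by exists p.
split => //; exists 1%N => //.
have hUU : iter 1 h @` U `<=` U.
  apply: connected_component_max; first by exists p.
    move=> _ [z /UA[m zm] <-]; apply: AF; exists m.
    rewrite -iterSr iterS; apply: le_lt_trans (hp _ zm) _.
    apply: le_lt_trans zm.
    by rewrite ler_pdivrMr // ler_peMr ?modulus_ge0 ?ler1n.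
  apply: connected_continuous_connected => //.
  exact: continuous_subspaceT.
rewrite /component_image; case: xgetP => [V _ [cV hV]|/(_ U)]; last by case.
rewrite (fatou_componentE cV (x := p)) //.
by apply: hV; exists p.
Qed.

Lemma iter_translate h T : (forall z, h (z + T) = h z + T) ->
  forall n z, iter n h z = iter n (fun z => h z - T) z + n%:R * T.
Proof.
move=> hT n z.
have hnT m w : h (w + m%:R * T) = h w + m%:R * T.
  elim: m => [|m ih]; first by rewrite mul0r !addr0.
  by rewrite -natr1 mulrDl mul1r !addrA hT ih.
elim: n => [|n ih] /=; first by rewrite mul0r addr0.
by rewrite ih hnT -natr1 mulrDl mul1r; ring.
Qed.

Lemma nat_translates_escape T (M : R) : T != 0 ->
  exists N, forall n, (N <= n)%N -> M < modulus (n%:R * T).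
Proof.
move=> T0; have mT : 0 < modulus T by rewrite -ltcR -normE normr_gt0.
exists (Num.bound `|M / modulus T|) => n Nn.
have -> : (n%:R : C) = (n%:R%:C)%C by rewrite rmorph_nat.
rewrite modulusM modulus_real normr_nat -ltr_pdivrMr //.
apply: le_lt_trans (ler_norm _) _.
apply: lt_le_trans (archi_boundP _) _ => //.
by rewrite ler_nat.
Qed.

(** Up to the translations by multiples of T, the iterates of h are those of
    the map h - T, which contracts at 0; thus the points n T form an escaping
    orbit inside the Fatou set.  The sets S k stand for disjoint regions, the
    k-th of which confines every connected set of escaping points that
    contains k T. *)
Lemma translated_wandering h T r (S : nat -> set C) : T != 0 -> 0 < r ->
  (forall z, h (z + T) = h z + T) -> contracting_at (fun z => h z - T) 0 r ->
  (forall k l, k <> l -> S k `&` S l = set0) ->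
  (forall V k, connected V -> V (k%:R * T) -> V `<=` escapes h -> V `<=` S k) ->
  lies_in_wandering h (modulus_ball 0 r).
Proof.
move=> T0 r0 hT hc disj hS.
have it n z : modulus (z - 0) < r -> modulus (iter n h z - n%:R * T) < r.
  move=> zr; rewrite (iter_translate hT) addrK -[X in modulus X]subr0.
  apply: le_lt_trans (contracting_iter n hc zr) _; apply: le_lt_trans zr.
  rewrite -[leRHS]mul1r.
  by rewrite ler_wpM2r ?modulus_ge0 // exprn_ile1 ?invr_ge0 ?invf_le1 ?ler1n.
have esc (M : R) : exists N, forall n, (N <= n)%N -> forall z,
    modulus_ball 0 r z -> M < modulus (iter n h z).
  have [N hN] := nat_translates_escape (M + r) T0.
  exists N => n /hN Mn z /(it n) zr.
  have := modulusD (n%:R * T - iter n h z) (iter n h z); rewrite subrK modulusB.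
  lra.
have B0 : modulus_ball 0 r (0 : C).
  by rewrite /modulus_ball /mkset subr0 modulus0.
have it0 n : iter n h 0 = n%:R * T.
  have h0 := contracting_fixed r0 hc.
  have fix0 m : iter m (fun z => h z - T) 0 = 0 by elim: m => [//|m /= ->].
  by rewrite (iter_translate hT) fix0 add0r.
have e0 n : escapes h (iter n h 0).
  move=> M; have [N hN] := esc M; exists N => m Nm.
  by rewrite -iterD; apply: hN B0; rewrite (leq_trans Nm) ?leq_addr.
have BF : modulus_ball 0 r `<=` Defs.fatou h.
  move=> z zr; exists (modulus_ball 0 r); split => //.
    exact: open_modulus_ball.
  apply: normal_iterates => n hn; right => K _ KB M.
  have [N hN] := esc M; exists N => // m /= Nm w /KB wB.
  by rewrite normE ltcR; apply: hN wB; exact: leq_trans Nm (hn m).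
exists (connected_component (Defs.fatou h) 0); last first.
  by apply: connected_component_max => //; exact: connected_modulus_ball.
have U0 : connected_component (Defs.fatou h) (0 : C) 0.
  by apply: connected_component_refl; exact: BF.
split; first by exists 0 => //; exact: BF.
have inS k : component_image h (connected_component (Defs.fatou h) 0) k
    `<=` S k.
  have [->|[-> Fk]] := component_imageP h k U0; first exact: sub0set.
  rewrite it0 in Fk *; apply: hS; first exact: component_connected.
    exact: connected_component_refl.
  move=> z Uz; apply: (escapes_connected (component_connected (x := _)))
    (connected_component_sub (x := _)) Uz _ (e0 k).
  by rewrite it0; exact: connected_component_refl.
move=> k l kl; rewrite -subset0 -(disj _ _ kl).
by apply: setISS; exact: inS.
Qed.

Definition strip (a b : R) : set C := [set z | a < complex.Im z < b].

Lemma connected_sub_strip (a b : R) (V : set C) w : connected V ->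
  V w -> strip a b w ->
  (forall z, V z -> complex.Im z != a /\ complex.Im z != b) ->
  V `<=` strip a b.
Proof.
move=> cV Vw sw hV z Vz.
apply: (connected_locally_constant cV) Vw Vz sw => x Vx.
have [xa xb] := hV _ Vx.
pose d := Num.min `|complex.Im x - a| `|complex.Im x - b|.
exists (modulus_ball x d); split; first exact: open_modulus_ball.
  by rewrite /modulus_ball /= subrr modulus0 lt_min !normr_gt0 !subr_eq0 xa xb.
move=> y; rewrite /modulus_ball /= lt_min => /andP[ya yb] _.
have := Im_le_modulus (y - x).
have -> : complex.Im (y - x) = complex.Im y - complex.Im x.
  by case: (y) (x) => ? ? [].
rewrite /strip /= => h; have {ya}ha := le_lt_trans h ya.
have {h yb}hb := le_lt_trans h yb.
move: xa xb ha hb; move: (complex.Im x) (complex.Im y) => s t sa sb.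
rewrite !neq_lt in sa sb.
have norm_cases c : (s < c) || (c < s) -> `|t - s| < `|s - c| ->
    (t < c) = (s < c) /\ (c < t) = (c < s).
  case/orP => sc; [rewrite [`|s - c|]ltr0_norm ?subr_lt0 //
                  |rewrite [`|s - c|]gtr0_norm ?subr_gt0 //];
    rewrite ltr_norml => /andP[? ?]; split; apply/idP/idP; lra.
by move=> /(norm_cases _ sa)[_ ->] /(norm_cases _ sb)[-> _].
Qed.

End PeriodicAndWandering.

(** * The real map induced on the invariant lines *)

Section RealDynamics.
Context {R : realType}.
Implicit Types (x y : R).

(** The action of [drift] on the lines where exp z is i times a positive real;
    see [drift_line]. *)
Definition line_map x : R :=
  x + 2^-1 - 3 * pi * expR x + expR x * expR x / 2
    - pi * (expR x * expR x * expR x).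

Lemma pi_bounds : 2 <= pi :> R /\ pi <= 4 :> R.
Proof.
have /andP[_ h] := @pihalf_02 R; split; first exact: pi_ge2.
by move: h; rewrite ltr_pdivrMr //; lra.
Qed.

Lemma line_map_right x : 64 < x -> line_map x < 0.
Proof.
move=> x0; have [p2 p4] := pi_bounds.
rewrite /line_map; have := expR_ge1Dx x; set t := expR x => tx.
have t1 : 65 < t by lra.
have t2 : t * t <= t * t * t by nra.
have t3 : 2 * (t * t * t) <= pi * (t * t * t) by apply: ler_wpM2r => //; nra.
have t4 : 6 * t <= 3 * pi * t by nra.
have t0 : 0 <= t * t by nra.
lra.
Qed.

Lemma line_map_left x : x < - 64 ->
  x + 4^-1 <= line_map x /\ line_map x <= x + 2^-1.
Proof.
move=> x0; have [p2 p4] := pi_bounds.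
have e0 := expR_gt0 x.
have e1 : expR x * 64 <= 1.
  rewrite -[expR x]invrK -expRN mulrC ler_pdivrMr ?expR_gt0 // mul1r.
  by apply: le_trans (expR_ge1Dx _); lra.
rewrite /line_map; move: (expR x) e0 e1 => t t0 t1.
have t2 : 0 <= t * t <= t by apply/andP; split; nra.
have t3 : 0 <= t * t * t <= t by apply/andP; split; nra.
have s1 : 3 * pi * t <= 12 * t by nra.
have s2 : pi * (t * t * t) <= 4 * t by nra.
have s3 : 6 * t <= 3 * pi * t by nra.
have s4 : 0 <= pi * (t * t * t) by nra.
split; lra.
Qed.

(** An orbit outside [-64, 64] from some time on would at some time be to the
    left of -64, since a point to the right of 64 has a negative image.  From
    there steps have length between 1/4 and 1/2, so the orbit moves right by
    at least 1/4 each time and cannot jump over the interval. *)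
Lemma line_map_recurrent x :
  ~ (forall M : R, exists N, forall n, (N <= n)%N -> M < `|iter n line_map x|).
Proof.
move=> /(_ 64)[N hN].
have [n0 [Nn0 hn0]] : exists n, (N <= n)%N /\ iter n line_map x < - 64.
  have := hN N (leqnn N); have := hN N.+1 (leqnSn N); rewrite !lter_normr.
  move=> /orP h1 /orP[/line_map_right h|h]; last by exists N; split => //; lra.
  by exists N.+1; split => //=; case: h1 => /= h1; lra.
have left j : iter (n0 + j) line_map x < -64 /\
    iter n0 line_map x + j%:R / 4 <= iter (n0 + j) line_map x.
  elim: j => [|j [ih1 ih2]]; first by rewrite addn0; split => //; lra.
  have [h1 h2] := line_map_left ih1; rewrite addnS /=.
  have := hN (n0 + j).+1; rewrite lter_normr /= => /(_ ltac:(lia)) /orP h3.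
  by rewrite -natr1; split; [case: h3 => h3; lra|lra].
have [h1 h2] := left (Num.bound `|4 * iter n0 line_map x|).
have := archi_boundP (normr_ge0 (4 * iter n0 line_map x)).
have := ler_norm (- (4 * iter n0 line_map x)); rewrite normrN.
lra.
Qed.
End RealDynamics.

(** * The two entire functions *)

Section Examples.
Context {R : realType}.
Local Notation C := (Cplx R).
Implicit Types (z w : C) (x y : R).

Definition pi_i : C := (0 +i* pi)%C.

(** In terms of the polynomial P w = 1/2 + 3 pi i w - w^2/2 - pi i w^3, this is
    z + P (exp z).  The conditions P 1 = 2 pi i and 1 + P' 1 = 0 give a
    superattracting point modulo translation at 0; P must also take real
    values on i times the real line, for the lines Im z = pi/2 + 2 pi k to be
    invariant.  A cubic is real there exactly if it is
    a + b i w + c w^2 + d i w^3 with real coefficients, and the two complex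
    conditions determine these.  The solution has P 0 > 0, and P (i t) tends
    to minus infinity as t grows, which [line_map_recurrent] relies on. *)
Definition drift z : C := z + (2^-1%:C)%C + 3 * pi_i * cexp z
  - (2^-1%:C)%C * (cexp z * cexp z) - pi_i * (cexp z * cexp z * cexp z).

Lemma two_pi_iE : two_pi_i = 2 * pi_i.
Proof.
rewrite /two_pi_i /pi_i; apply/eqP; rewrite eq_complex /=.
by apply/andP; split; apply/eqP; ring.
Qed.

Lemma drift0 : drift 0 = two_pi_i.
Proof. by rewrite /drift cexp0 two_pi_iE; ring. Qed.

Lemma drift_translate z : drift (z + two_pi_i) = drift z + two_pi_i.
Proof. by rewrite /drift cexp_period; ring. Qed.

Lemma drift_line x y : cos y = 0 -> sin y = 1 ->
  drift (x +i* y)%C = (line_map x +i* y)%C.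
Proof.
move=> cy sy; rewrite /drift /cexp /= cy sy mulr0 mulr1 /line_map.
apply/eqP; rewrite eq_complex /=.
by apply/andP; split; apply/eqP; ring.
Qed.

Lemma half_double w : (2^-1%:C)%C * (w + w) = w.
Proof.
have -> : (2^-1%:C)%C * (w + w) = (2^-1 + 2^-1)%:C%C * w.
  by rewrite rmorphD; ring.
have -> : 2^-1 + 2^-1 = 1 :> R by lra.
by rewrite rmorph1 mul1r.
Qed.

Lemma is_derive_drift z : is_derive z 1 drift (1 + 3 * pi_i * cexp z
  - cexp z * cexp z - 3 * pi_i * (cexp z * cexp z * cexp z)).
Proof.
have hE := is_derive_cexp z.
have hE2 := is_deriveM hE hE; have hE3 := is_deriveM hE2 hE.
have hsum := is_deriveB (is_deriveB (is_deriveD (is_deriveD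
  (is_derive_id z 1) (is_derive_cst ((2^-1%:C)%C : C) z 1))
  (is_deriveZ (3 * pi_i) hE))
  (is_deriveZ ((2^-1%:C)%C : C) hE2)) (is_deriveZ pi_i hE3).
have {}hsum : is_derive z 1 drift _ := hsum.
apply: is_derive_eq.
rewrite /GRing.scale /= half_double -[(cexp * cexp) z]/(cexp z * cexp z).
ring.
Qed.

Lemma line_not_escaping x y : cos y = 0 -> sin y = 1 ->
  ~ escapes drift (x +i* y)%C.
Proof.
move=> cy sy esc; apply: (@line_map_recurrent R x) => M.
have [N hN] := esc (M + `|y|); exists N => n /hN.
have -> : iter n drift (x +i* y)%C = (iter n line_map x +i* y)%C.
  by elim: n => [//|n /= ->]; rewrite drift_line.
have -> : (iter n line_map x +i* y)%C =
   ((iter n line_map x)%:C)%C + (y *i)%C :> C.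
  by apply/eqP; rewrite eq_complex /= addr0 add0r !eqxx.
have := modulusD ((iter n line_map x)%:C)%C (y *i)%C.
rewrite modulus_real modulus_im; lra.
Qed.

Lemma two_pi_i_neq0 : two_pi_i != 0 :> C.
Proof.
rewrite eq_complex /= eqxx /= -mulr_natl mulf_neq0 ?pnatr_eq0 //.
exact/lt0r_neq0/pi_gt0.
Qed.

Lemma cexp_pi_i : cexp pi_i = -1 :> C.
Proof.
rewrite /cexp /pi_i /= expR0 cospi sinpi; apply/eqP.
by rewrite eq_complex /= !mul1r oppr0 !eqxx.
Qed.

(** A periodic function that is polynomial vanishes as soon as it has one zero;
    both transcendence proofs rest on this. *)
Lemma poly_eq0_of_progression (T : C) (q : {poly C}) : T != 0 ->
  (forall n : nat, q.[n%:R * T] = 0) -> q = 0.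
Proof.
move=> T0 hq; apply: contrapT => /eqP q0.
have := @max_poly_roots _ q [seq n%:R * T | n <- iota 0 (size q)] q0.
rewrite size_map size_iota ltnn => h; suff : false by [].
apply: h.
  by apply/allP => _ /mapP[n _ ->]; apply/rootP.
rewrite map_inj_uniq ?iota_uniq // => m n /(mulIf T0) /eqP.
by rewrite eqr_nat => /eqP.
Qed.

(** If [drift] were a polynomial, then so would be the periodic function
    drift z - z - 2 pi i, which vanishes at the multiples of 2 pi i but not at
    pi i. *)
Lemma drift_transcendental : transcendental_entire (drift : C -> C).
Proof.
split=> [z|[p hp]]; first by have [] := is_derive_drift z.
have q0 : p - 'X - two_pi_i%:P = 0.
  apply: (poly_eq0_of_progression two_pi_i_neq0) => n.
  have := cexp_period_nat (0 : C) n; rewrite add0r cexp0 => en.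
  by rewrite !hornerE -hp /drift en two_pi_iE; ring.
have := congr1 (fun q => q.[pi_i]) q0.
rewrite !hornerE -hp /drift cexp_pi_i two_pi_iE => h.
have : 4 * pi_i = 0 :> C by rewrite -[RHS]oppr0 -h; ring.
have := two_pi_i_neq0; rewrite two_pi_iE mulf_eq0 => /norP[_ c0].
by move/eqP; rewrite mulf_eq0 (negbTE c0) pnatr_eq0.
Qed.

Lemma drift_contracting : exists2 r : R, 0 < r &
  contracting_at (fun z : C => drift z - two_pi_i) 0 r.
Proof.
have [|d d0 hd] := derive_modulus (is_derive_drift (0 : C)) (e := 2^-1).
  by rewrite invr_gt0.
exists d => // z; rewrite !subr0 => /hd.
rewrite addr0 drift0 cexp0 !mulr1 [1 + _ - 1]addrC addKr subrr mul0r subr0.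
by rewrite mulrC.
Qed.

(** The strip between two consecutive invariant lines contains exactly one
    multiple of 2 pi i, and sets of escaping points avoid the lines. *)
Lemma drift_wandering (r : R) : 0 < r ->
  contracting_at (fun z : C => drift z - two_pi_i) 0 r ->
  lies_in_wandering drift (modulus_ball (0 : C) r).
Proof.
move=> r0 hr.
pose b k : R := pi / 2 + (pi *+ 2) *+ k.
pose a k : R := pi / 2 - (pi *+ 2) + (pi *+ 2) *+ k.
have line_b k : cos (b k) = 0 /\ sin (b k) = 1.
  rewrite !(periodicn (@cosD2pi R), periodicn (@sinD2pi R)).
  by rewrite cos_pihalf sin_pihalf.
have line_a k : cos (a k) = 0 /\ sin (a k) = 1.
  rewrite !(periodicn (@cosD2pi R), periodicn (@sinD2pi R)).
  by rewrite -cosD2pi -sinD2pi subrK cos_pihalf sin_pihalf.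
have pi0 := pi_gt0 R.
apply: (translated_wandering (S := fun k => strip (a k) (b k))
  two_pi_i_neq0 r0 drift_translate hr).
  have disj k l : (k < l)%N -> strip (a k) (b k) `&` strip (a l) (b l) = set0.
    move=> kl; rewrite -subset0 => z [/andP[_ zk] /andP[zl _]].
    have := lt_trans zl zk; apply/negP; rewrite -leNgt /a /b -addrA lerD2l.
    rewrite addrC lerBrDr -mulrSr ler_pMn2l //.
    by rewrite mulrn_wgt0.
  move=> k l /eqP; rewrite neq_ltn => /orP[|/disj] kl; first exact: disj.
  by rewrite setIC.
move=> V k cV Vk esc; apply: (connected_sub_strip cV Vk).
  have -> : k%:R * two_pi_i = (0 +i* ((pi *+ 2) *+ k))%C :> C.
    elim: k {Vk} => [|k ih].
      by apply/eqP; rewrite mul0r eq_complex /= !eqxx.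
    rewrite -natr1 mulrDl mul1r ih; apply/eqP; rewrite eq_complex /=.
    by rewrite addr0 eqxx /= addrC -mulrS.
  rewrite /strip /= /a /b; apply/andP; split; lra.
move=> [x y] /esc; rewrite [complex.Im _]/= => ez.
split; apply/eqP => yE; rewrite yE in ez.
  by have [c s] := line_a k; exact: line_not_escaping c s ez.
by have [c s] := line_b k; exact: line_not_escaping c s ez.
Qed.

Definition small_exp (e : R) z : C := (e%:C)%C * (cexp z - 1).

Lemma small_exp_period e z : small_exp e (z + two_pi_i) = small_exp e z.
Proof. by rewrite /small_exp cexp_period. Qed.

Lemma small_exp_transcendental e : 0 < e -> transcendental_entire (small_exp e).
Proof.
move=> e0; split=> [z|[p hp]].
  have hE := is_derive_cexp z.
  have h := is_deriveZ ((e%:C)%C : C)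
    (is_deriveB hE (is_derive_cst (1 : C) z 1)).
  by have {}h : is_derive z 1 (small_exp e) _ := h; case: h.
have p0 : p = 0.
  apply: (poly_eq0_of_progression two_pi_i_neq0) => n.
  have := cexp_period_nat (0 : C) n; rewrite add0r cexp0 => en.
  by rewrite -hp /small_exp en subrr mulr0.
have := hp pi_i; rewrite p0 horner0 /small_exp cexp_pi_i => /eqP.
rewrite mulf_eq0 -opprD oppr_eq0 -[1 + 1]/(2%:R : C) pnatr_eq0 orbF.
by move=> /eqP[] e1; move: e0; rewrite e1 ltxx.
Qed.

Lemma entire_continuous (h : C -> C) : entire h -> continuous h.
Proof.
move=> hh z; apply: differentiable_continuous.
exact/derivable1_diffP.
Qed.

Lemma small_exp_near0 : exists2 d : R, 0 < d & forall e z, 0 < e ->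
  modulus z < d -> modulus (small_exp e z) <= e * (2 * modulus z).
Proof.
have [d d0 hd] := @cexp_derive0 R 1 ltr01; exists d => // e z e0 /hd hz.
rewrite /small_exp modulusM modulus_real gtr0_norm // ler_pM2l //.
rewrite -[X in modulus X](subrK z); apply: le_trans (modulusD _ _) _; lra.
Qed.

Lemma small_exp_bound (e M : R) z : 0 < e -> modulus z <= M ->
  modulus (small_exp e z) <= e * (expR M + 1).
Proof.
move=> e0 zM; rewrite /small_exp modulusM modulus_real gtr0_norm // ler_pM2l //.
apply: le_trans (modulusD _ _) _; rewrite modulusN modulus_cexp.
rewrite [modulus 1]ComplexField.Normc.normc1 lerD2r ler_expR.
exact: le_trans (le_trans (ler_norm _) (Re_le_modulus z)) zM.
Qed.

End Examples.

Theorem theorem2p9 (R : realType) :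
  exists (f g : Cplx R -> Cplx R) (D : set (Cplx R)),
    transcendental_entire f /\ transcendental_entire g /\ is_domain D /\
    lies_in_periodic f D /\ lies_in_wandering g D /\
    lies_in_periodic (g \o f) D /\ lies_in_periodic (f \o g) D.
Proof.
have [rg rg0 hrg] := @drift_contracting R.
have [d d0 hd] := @small_exp_near0 R.
pose r := Num.min rg (Num.min d 1).
have r0 : 0 < r by rewrite !lt_min rg0 d0 ltr01.
have rrg : r <= rg by rewrite ge_min lexx.
have rd : r <= d by rewrite !ge_min lexx orbT.
have r1 : r <= 1 by rewrite !ge_min lexx !orbT.
have hr : contracting_at (fun z : Cplx R => drift z - two_pi_i) 0 r.
  by move=> z zr; apply: hrg; exact: lt_le_trans zr rrg.
(* [M] bounds |exp z - 1| for |z| <= 10. *)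
pose M : R := expR 10 + 1.
have M1 : 1 <= M by rewrite lerDr expR_ge0.
(* This makes f smaller than r / 2 on the disc of radius 10 around 0, and at
   the same time small enough to contract near 0. *)
pose e := r / (4 * M).
have M0 : 0 < 4 * M by lra.
have e0 : 0 < e by rewrite divr_gt0.
have eM : e * M = r / 4 by rewrite /e; field; rewrite lt0r_neq0 //; lra.
have e4 : e <= 4^-1 by nra.
have fnear z : modulus z < r -> modulus (small_exp e z) <= modulus z / 2.
  move=> zr; apply: le_trans (hd _ _ e0 (lt_le_trans zr rd)) _.
  have := modulus_ge0 z; nra.
have fg_lt z : modulus z < r -> modulus (small_exp e z) < r.
  by move=> zr; have := fnear z zr; have := modulus_ge0 z; lra.
have fT z : small_exp e z = small_exp e (z - two_pi_i).
  by rewrite -(small_exp_period e (z - _)) subrK.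
have cf : continuous (@small_exp R e).
  by apply: entire_continuous; case: (small_exp_transcendental e0).
have cg : continuous (@drift R).
  by apply: entire_continuous; case: (@drift_transcendental R).
have B0 (p : Cplx R) s : 0 < s -> modulus_ball p s p.
  by rewrite /modulus_ball /mkset subrr modulus0.
exists (small_exp e), drift, (modulus_ball 0 r).
split; first exact: small_exp_transcendental.
split; first exact: drift_transcendental.
split.
  split; [by exists 0; exact: B0|exact: open_modulus_ball|].
  exact: connected_modulus_ball.
split.
  apply: (attracting_periodic cf r0 (p := 0) _
    (@connected_modulus_ball _ 0 r)) => //.
  - by move=> z; rewrite !subr0; exact: fnear.
  - exact: B0.
  - exact: ball_sub_basin.
split; first exact: drift_wandering.
have hgr z : modulus z < r -> modulus (drift z - two_pi_i) <= modulus z / 2.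
  by move=> zr; have := hr z; rewrite !subr0; apply.
split.
(* Radius 10 suffices for the disc around 2 pi i to contain the domain, since
   r + 2 pi <= 1 + 8; translating by 2 pi i brings this disc back to 0. *)
- have cgf : continuous (@drift R \o @small_exp R e).
    by move=> z; apply: continuous_comp; [exact: cf|exact: cg].
  apply: (attracting_periodic cgf r0 (p := two_pi_i) _
    (@connected_modulus_ball _ two_pi_i 10)) => //.
  + move=> z zr.
    have -> : (drift \o small_exp e) z = drift (small_exp e (z - two_pi_i)).
      by rewrite -fT.
    have := hgr _ (fg_lt _ zr).
    have := fnear _ zr; have := modulus_ge0 (z - two_pi_i); lra.
  + exact: B0.
  + move=> z zr; exists 1%N; rewrite iterS /comp.
    have fz : modulus (small_exp e z) < r.
      rewrite fT; apply: le_lt_trans (small_exp_bound (M := 10) e0 _) _.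
        by move: zr; rewrite /modulus_ball /=; lra.
      by rewrite -/M eM; lra.
    by have := hgr _ fz; have := modulus_ge0 (small_exp e z); lra.
  + move=> z; rewrite /modulus_ball /mkset subr0 => zr.
    apply: le_lt_trans (modulusD _ _) _; rewrite modulusN /two_pi_i.
    have [p2 p4] := @pi_bounds R.
    by rewrite modulus_im ger0_norm; lra.
- have cfg : continuous (@small_exp R e \o @drift R).
    by move=> z; apply: continuous_comp; [exact: cg|exact: cf].
  apply: (attracting_periodic cfg r0 (p := 0) _
    (@connected_modulus_ball _ 0 r)) => //.
  + move=> z; rewrite !subr0 => zr.
    have -> : (small_exp e \o drift) z = small_exp e (drift z - two_pi_i).
      by rewrite -fT.
    have h1 := hgr _ zr; have z0 := modulus_ge0 z.
    by have h2 := fnear (drift z - two_pi_i); lra.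
  + exact: B0.
  + exact: ball_sub_basin.
Qed.
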